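(* Let $h>0$ be a natural number and $\mathcal V$ a variety. The following conditions (1) and (2) are equivalent, and each condition holds for $\mathcal V$ if and only if it holds for $\mathbf F_{\mathcal V}(3)$. (1) $\mathcal V$ satisfies $\alpha\cap(\sigma\circ\sigma)\subseteq(\alpha\cap\sigma)^{\circ h}$, where $\sigma$ ranges over U-admissible relations; equivalently, over U$_2$-admissible relations. (2) There is a function $f:\{0,1,\dots,h-1\}\to\{1,2\}$ such that one (and hence all) of the following conditions, which are equivalent to each other for any given $f$, hold: (a) $\mathcal V$ satisfies $$\alpha\cap(R_1\circ R_2)\subseteq(\alpha\cap R_{f(0)})\circ(\alpha\cap R_{f(1)})\circ\cdots\circ(\alpha\cap R_{f(h-1)}),$$ where $R_1$ and $R_2$ range over reflexive and admissible relations. (b) $\mathcal V$ has $4$-ary terms $s_i$, $i=0,\dots,h-1$, such that the following identities hold throughout $\mathcal V$: $$x=s_0(x,y,z;w_{f(0)}),\qquad s_{h-1}(x,y,z;w'_{f(h-1)})=z,$$ and, for $0\le i<h-1$, $$s_i(x,y,z;w'_{f(i)})=s_{i+1}(x,y,z;w_{f(i+1)}),\qquad x=s_{i+1}(x,y,x;w_{f(i+1)}),$$ where $w_1,w_2,w'_1,w'_2$ denote, respectively, the variables $x,y,y,z$. In (1) and (2)(a), $\alpha$ can be taken, equivalently, to range over congruences or over tolerances.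
   Context: A binary relation on an algebra $\mathbf A$ is admissible if it is compatible with all operations. A tolerance is a reflexive, symmetric and admissible relation. A relation is U-admissible if it is the set-theoretical union of some nonempty set of reflexive and admissible relations on $\mathbf A$; it is U$_2$-admissible if it is the union of two reflexive and admissible relations. $\circ$ is relational composition and $R^{\circ h}=R\circ\cdots\circ R$ with $h$ factors. $\mathcal V$ satisfies an inclusion if the inclusion holds in every algebra of $\mathcal V$ for all relations of the specified kinds. $\mathbf F_{\mathcal V}(3)$ is the free algebra in $\mathcal V$ generated by 3 elements. The semicolon in $s_i(x,y,z;w)$ merely separates the fourth argument. *)

(* Defs.v *)
From mathcomp Require Import all_boot.
From mathcomp Require Import boolp classical_sets.

Set Implicit Arguments.
Unset Strict Implicit.
Unset Printing Implicit Defensive.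

Local Open Scope classical_set_scope.

Record signature := Signature {
  symbol : Type;
  arity : symbol -> nat
}.

Record algebra (S : signature) := Algebra {
  carrier :> Type;
  op : forall o : symbol S, ('I_(arity o) -> carrier) -> carrier;
  carrier_inhabited : inhabited carrier
}.

Arguments op {S} A o _ : rename.
Arguments Algebra {S} _ _ _.

Inductive term (S : signature) (X : Type) : Type :=
| Var of X
| App (o : symbol S) of ('I_(arity o) -> term S X).

Arguments Var {S X} _.
Arguments App {S X} o _.

Fixpoint eval (S : signature) (X : Type) (A : algebra S) (e : X -> A)
    (t : term S X) : A :=
  match t with
  | Var x => e x
  | App o ts => op A o (fun i => eval e (ts i))
  end.

(* The two terms of an identity share the countable supply [nat] of
   variables. *)
Definition models (S : signature) (E : set (term S nat * term S nat)) :
    algebra S -> Prop :=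
  fun A => forall st, E st -> forall e : nat -> A, eval e st.1 = eval e st.2.

Definition is_variety (S : signature) (V : algebra S -> Prop) : Prop :=
  exists E, V = models E.

Definition homomorphism (S : signature) (A B : algebra S) (phi : A -> B) :
    Prop :=
  forall (o : symbol S) (a : 'I_(arity o) -> A),
    phi (op A o a) = op B o (phi \o a).

Definition free_algebra (S : signature) (V : algebra S -> Prop) (X : Type)
    (F : algebra S) (g : X -> F) : Prop :=
  V F /\
  forall B : algebra S, V B -> forall e : X -> B,
    exists! phi : F -> B, homomorphism phi /\ phi \o g = e.

Section Relations.
Variables (S : signature) (A : algebra S).
Implicit Types (R T : set (A * A)).

Definition admissible R : Prop :=
  forall (o : symbol S) (a b : 'I_(arity o) -> A),
    (forall i, R (a i, b i)) -> R (op A o a, op A o b).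

Definition reflexive_rel R : Prop := forall x, R (x, x).

Definition symmetric_rel R : Prop := forall x y, R (x, y) -> R (y, x).

Definition transitive_rel R : Prop :=
  forall x y z, R (x, y) -> R (y, z) -> R (x, z).

Definition reflexive_admissible R : Prop := reflexive_rel R /\ admissible R.

Definition tolerance R : Prop :=
  [/\ reflexive_rel R, symmetric_rel R & admissible R].

Definition congruence R : Prop :=
  [/\ reflexive_rel R, symmetric_rel R, transitive_rel R & admissible R].

Definition U_admissible R : Prop :=
  exists Phi : set (set (A * A)),
    [/\ Phi !=set0, Phi `<=` reflexive_admissible
      & R = \bigcup_(T in Phi) T].

Definition U2_admissible R : Prop :=
  exists T1 T2 : set (A * A),
    [/\ reflexive_admissible T1, reflexive_admissible T2 & R = T1 `|` T2].

(* [(x, z)] is in [rcomp R T] when [x R y T z] for some [y]: the library's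
   [\;] takes its arguments in the opposite order. *)
Definition rcomp R T : set (A * A) := (T \; R)%relation.

(* [Q 0 o Q 1 o ... o Q (h - 1)]. *)
Definition rcomp_family (h : nat) (Q : 'I_h -> set (A * A)) : set (A * A) :=
  \big[rcomp/diagonal]_(i < h) Q i.

End Relations.

(* The index set {1, 2}. *)
Inductive idx12 := idx1 | idx2.

(* The possible ranges of the variables alpha and sigma. *)
Inductive alpha_range := Congruences | Tolerances.
Inductive sigma_range := UAdmissible | U2Admissible.

Definition in_alpha_range (ra : alpha_range) (S : signature) (A : algebra S) :
    set (set (A * A)) :=
  match ra with
  | Congruences => @congruence S A
  | Tolerances => @tolerance S A
  end.

Definition in_sigma_range (rs : sigma_range) (S : signature) (A : algebra S) :
    set (set (A * A)) :=
  match rs with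
  | UAdmissible => @U_admissible S A
  | U2Admissible => @U2_admissible S A
  end.

Section Conditions.
Variables (S : signature) (h : nat).

(* The conditions are about an arbitrary class [K] of algebras, so that they
   apply both to a variety and, with [K := eq F], to a single algebra [F]. *)
Implicit Types (K : algebra S -> Prop) (f : 'I_h -> idx12).

Definition condition_U (ra : alpha_range) (rs : sigma_range) K : Prop :=
  forall A : algebra S, K A ->
  forall alpha sigma : set (A * A),
    in_alpha_range ra alpha -> in_sigma_range rs sigma ->
    alpha `&` rcomp sigma sigma
      `<=` rcomp_family (fun _ : 'I_h => alpha `&` sigma).

Definition condition_R (ra : alpha_range) f K : Prop :=
  forall A : algebra S, K A ->
  forall (alpha : set (A * A)) (R : idx12 -> set (A * A)),
    in_alpha_range ra alpha -> (forall j, reflexive_admissible (R j)) ->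
    alpha `&` rcomp (R idx1) (R idx2)
      `<=` rcomp_family (fun i : 'I_h => alpha `&` R (f i)).

Definition eval4 (A : algebra S) (t : term S 'I_4) (x y z w : A) : A :=
  eval (tnth [tuple x; y; z; w]) t.

Definition w_ (A : Type) (j : idx12) (x y z : A) : A :=
  match j with idx1 => x | idx2 => y end.

Definition w'_ (A : Type) (j : idx12) (x y z : A) : A :=
  match j with idx1 => y | idx2 => z end.

Definition term_identities f (s : 'I_h -> term S 'I_4) (A : algebra S) : Prop :=
  forall x y z : A,
  [/\ forall i : 'I_h, i = 0 :> nat ->
        x = eval4 (s i) x y z (w_ (f i) x y z),
      forall i : 'I_h, i.+1 = h ->
        eval4 (s i) x y z (w'_ (f i) x y z) = z,
      forall i j : 'I_h, j = i.+1 :> nat ->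
        eval4 (s i) x y z (w'_ (f i) x y z) =
        eval4 (s j) x y z (w_ (f j) x y z)
    & forall i j : 'I_h, j = i.+1 :> nat ->
        x = eval4 (s j) x y x (w_ (f j) x y x)].

Definition condition_terms f K : Prop :=
  exists s : 'I_h -> term S 'I_4, forall A, K A -> term_identities f s A.

Definition condition_f K : Prop :=
  exists f, (exists ra, condition_R ra f K) \/ condition_terms f K.

End Conditions.

Arguments condition_U {S} h ra rs K.
Arguments condition_f {S} h K.

(* Free algebras over a nonempty set exist: terms modulo the identities that
   hold throughout the variety. *)
Section FreeAlgebraExists.
Variables (S : signature) (V : algebra S -> Prop) (X : Type) (x0 : X).
Hypothesis varV : is_variety V.

Let T := term S X.

Let eqv (t u : T) : Prop :=
  forall B : algebra S, V B -> forall e : X -> B, eval e t = eval e u.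

Let Q := {C : T -> Prop | exists t, C = eqv t}.

Let cls (t : T) : Q := exist _ (eqv t) (ex_intro _ t erefl).

Let clsP t u : eqv t u -> cls t = cls u.
Proof.
move=> tu; apply: eq_exist; apply/funext => v; apply/propext; split=> H B VB e.
  by rewrite -tu // H.
by rewrite tu // H.
Qed.

Let cls_inj t u : cls t = cls u -> eqv t u.
Proof.
move=> /(congr1 (@sval _ _)) /= tu.
by have : eqv u u by []; rewrite -{1}tu.
Qed.

Let repr (q : Q) : {t | q = cls t}.
Proof.
apply: cid; case: q => C CP; case: (CP) => t Ct; exists t.
exact: eq_exist.
Qed.

Let rep q := sval (repr q).

Let repK q : cls (rep q) = q.
Proof. by rewrite /rep; case: (repr q) => t /= ->. Qed.

Let F : algebra S :=
  Algebra Q (fun o (a : 'I_(arity o) -> Q) => cls (App o (rep \o a)))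
          (inhabits (cls (Var x0))).

Let op_cls o (ts : 'I_(arity o) -> T) :
  op F o (cls \o ts) = cls (App o ts).
Proof.
apply: clsP => B VB e /=; congr (op _ _); apply/funext => i /=.
by apply: cls_inj => //; exact: repK.
Qed.

Let subst (Y : Type) (r : Y -> T) : term S Y -> T :=
  fix go t := match t with Var y => r y | App o ts => App o (go \o ts) end.

Let eval_F (Y : Type) (r : Y -> T) (t : term S Y) :
  eval (A := F) (cls \o r) t = cls (subst r t).
Proof.
elim: t => [//|o ts IH].
transitivity (op F o (cls \o (subst r \o ts))); last exact: op_cls.
by congr (op F o); apply/funext => i; exact: IH.
Qed.

Let eval_subst (Y : Type) (r : Y -> T) (B : algebra S) (e : X -> B) t :
  eval e (subst r t) = eval (fun y => eval e (r y)) t.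
Proof.
elim: t => //= o ts IH; congr (op _ _).
by apply/funext => i /=; exact: IH.
Qed.

Lemma free_algebra_exists : exists (F : algebra S) (g : X -> F),
  free_algebra V g.
Proof.
exists F, (cls \o Var); split.
  have [E VE] := varV; rewrite VE => -[s t] Est /= e.
  have -> : e = cls \o (rep \o e) by apply/funext => n /=; rewrite repK.
  rewrite !eval_F; apply: clsP => B VB e'; rewrite !eval_subst.
  by move: VB; rewrite VE => /(_ _ Est).
move=> B VB e; exists (fun q => eval e (rep q)); split.
  have evr t : eval e (rep (cls t)) = eval e t.
    by apply: cls_inj => //; exact: repK.
  split; last by apply/funext => x /=; rewrite evr.
  by move=> o a /=; rewrite evr.
move=> phi [hphi phig]; apply/funext => q; rewrite -[in RHS](repK q).
elim: (rep q) => [x|o ts IH] /=; first by rewrite -phig.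
rewrite -op_cls hphi; congr (op _ _); apply/funext => i /=; exact: IH.
Qed.

End FreeAlgebraExists.

(* Main.v *)
Require Import Defs.
From mathcomp Require Import all_boot.
From mathcomp Require Import boolp classical_sets.

(** Why the theorem is true.

    The terms [s_i] are a uniform recipe for factoring a pair of
    [alpha `&` rcomp R_1 R_2].  Given [x R_1 y R_2 z], the elements
    [s_i(x, y, z; w_(f i))], followed by [z], form a chain from [x] to [z]:
    its [i]-th step only moves the fourth argument of [s_i] from [w_(f i)] to
    [w'_(f i)], so it lies in [R_(f i)].  For a congruence [alpha] all elements
    of the chain are [alpha]-related to [x], because
    [s_i(x, y, x; w_(f i)) = x]; a tolerance needs the nesting argument of
    [tolerance_step] instead.  Thus the terms give the inclusion for
    [R_1] and [R_2] in every algebra in which the identities hold (lemma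
    [condition_R_of_terms]).  The inclusion for a union [sigma] of reflexive
    and admissible relations follows, with [R_1] and [R_2] the two members of
    the union that a given pair of [rcomp sigma sigma] uses (lemma
    [condition_U_of_R]).

    Conversely, in the algebra freely generated by [x], [y], [z] it suffices to
    test one congruence and two relations: [alpha] is the kernel of the
    homomorphism sending [x, y, z] to [x, y, x], and [R_j] (here [shift_rel])
    consists of the pairs [(t(x, y, z; w_j), t(x, y, z; w'_j))] with [t] a
    term, the admissible relation generated by the diagonal and one pair of
    generators.  Reading off the terms behind a chain from [x] to [z] in
    [alpha] and the [R_j], and moving the resulting equalities between elements
    of the free algebra to all of [V] by the universal property, yields the
    identities (lemma [terms_of_chain]).  If only the inclusion for
    the union of [R_1] and [R_2] is available, each step of the chain selects
    its own [R_j], and these selections are the function [f].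

    Every condition considered passes from [V] to the free algebra and from
    wider to narrower ranges of the variables, and the weakest of them, the one
    for the free algebra, congruences and unions of two relations, already
    produces the terms; so all implications close up into cycles. *)

Set Implicit Arguments.
Unset Strict Implicit.
Unset Printing Implicit Defensive.

Local Open Scope classical_set_scope.

(** * Compositions as chains *)

Lemma rcomp_familyP (S : signature) (A : algebra S) (h : nat)
    (Q : 'I_h -> set (A * A)) (x z : A) :
  rcomp_family Q (x, z) <->
  exists c : nat -> A, [/\ c 0 = x, c h = z & forall i : 'I_h, Q i (c i, c i.+1)].
Proof.
rewrite /rcomp_family; elim: h Q x => [|h IH] Q x.
  rewrite big_ord0; split=> [|[c [<- <- _]]] //.
  by rewrite /diagonal /= => <-; exists (fun=> x); split=> //; case.
rewrite big_ord_recl; split.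
  case=> y /= Qxy /IH [c [c0 ch Qc]].
  exists (fun n => if n is m.+1 then c m else x); split=> // i.
  case: (unliftP ord0 i) => [j|] -> /=; first exact: Qc.
  by rewrite c0.
case=> c [c0 ch Qc]; exists (c 1); first by rewrite -c0; exact: (Qc ord0).
apply/IH; exists (c \o succn); split=> //.
Qed.

Lemma sub_rcomp_family (S : signature) (A : algebra S) (h : nat)
    (Q Q' : 'I_h -> set (A * A)) :
  (forall i, Q i `<=` Q' i) -> rcomp_family Q `<=` rcomp_family Q'.
Proof.
move=> QQ' [x z] /rcomp_familyP [c [c0 ch Qc]].
by apply/rcomp_familyP; exists c; split=> // i; exact/QQ'.
Qed.

(** The selection of a member of the union at each step is where the function
    [f] of the theorem comes from. *)
Lemma rcomp_family_bigcup (S : signature) (A : algebra S) (h : nat) (J : Type)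
    (alpha : set (A * A)) (R : J -> set (A * A)) (p : A * A) :
  rcomp_family (fun _ : 'I_h => alpha `&` \bigcup_j R j) p ->
  exists f : 'I_h -> J, rcomp_family (fun i => alpha `&` R (f i)) p.
Proof.
case: p => x z /rcomp_familyP [c [c0 ch Qc]].
have /choice [f Rf] : forall i : 'I_h, exists j, R j (c i, c i.+1).
  by move=> i; have [_ [j _ Rj]] := Qc i; exists j.
exists f; apply/rcomp_familyP; exists c; split=> // i.
by split; [have [] := Qc i | exact: Rf].
Qed.

(** * Terms, admissible relations and homomorphisms *)

Lemma forall_ord4 (P : 'I_4 -> Prop) :
  P (inord 0) -> P (inord 1) -> P (inord 2) -> P (inord 3) -> forall i, P i.
Proof.
move=> P0 P1 P2 P3 i; rewrite -[i]inord_val.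
by case: i => [[|[|[|[|//]]]] ?].
Qed.

Lemma admissible_eval4 (S : signature) (A : algebra S) (R : set (A * A))
    (t : term S 'I_4) (x x' y y' z z' w w' : A) :
  admissible R -> R (x, x') -> R (y, y') -> R (z, z') -> R (w, w') ->
  R (eval4 t x y z w, eval4 t x' y' z' w').
Proof.
move=> admR Rx Ry Rz Rw; rewrite /eval4; elim: t => [i|o ts IH] /=.
  by move: i; apply: forall_ord4; rewrite !(tnth_nth x) !inordK.
exact: admR.
Qed.

Lemma homomorphism_eval (S : signature) (X : Type) (A B : algebra S)
    (phi : A -> B) (e : X -> A) (t : term S X) :
  homomorphism phi -> phi (eval e t) = eval (phi \o e) t.
Proof.
move=> hphi; elim: t => [//|o ts IH] /=.
by rewrite hphi; congr (op _ _); apply/funext => i; exact: IH.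
Qed.

Lemma homomorphism_eval4 (S : signature) (A B : algebra S) (phi : A -> B)
    (t : term S 'I_4) (x y z w : A) :
  homomorphism phi ->
  phi (eval4 t x y z w) = eval4 t (phi x) (phi y) (phi z) (phi w).
Proof.
move=> hphi; rewrite /eval4 homomorphism_eval //; congr (eval _ t).
apply/funext; apply: forall_ord4 => /=;
  by rewrite (tnth_nth x) (tnth_nth (phi x)) !inordK.
Qed.

Lemma homomorphism_w (A B : Type) (phi : A -> B) (j : idx12) (x y z : A) :
  phi (w_ j x y z) = w_ j (phi x) (phi y) (phi z).
Proof. by case: j. Qed.

Lemma homomorphism_w' (A B : Type) (phi : A -> B) (j : idx12) (x y z : A) :
  phi (w'_ j x y z) = w'_ j (phi x) (phi y) (phi z).
Proof. by case: j. Qed.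

Lemma congruence_kernel (S : signature) (A B : algebra S) (phi : A -> B) :
  homomorphism phi -> congruence [set p : A * A | phi p.1 = phi p.2].
Proof.
move=> hphi; split=> // [x y z /= -> //|o a b /= ab].
by rewrite !hphi; congr (op _ _); apply/funext.
Qed.

Lemma tolerance_in_alpha_range (S : signature) (A : algebra S)
    (ra : alpha_range) (alpha : set (A * A)) :
  in_alpha_range ra alpha -> tolerance alpha.
Proof. by case: ra => //= -[]. Qed.

Lemma congruence_in_alpha_range (S : signature) (A : algebra S)
    (ra : alpha_range) (alpha : set (A * A)) :
  congruence alpha -> in_alpha_range ra alpha.
Proof. by case: ra => //= -[]. Qed.

Lemma U2_admissibleP (S : signature) (A : algebra S)
    (R : idx12 -> set (A * A)) :
  (forall j, reflexive_admissible (R j)) -> U2_admissible (\bigcup_j R j).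
Proof.
move=> adR; exists (R idx1), (R idx2); split=> //.
apply/seteqP; split=> p; first by case=> -[]; [left | right].
by case=> Rp; [exists idx1 | exists idx2].
Qed.

Lemma U_admissible_of_U2 (S : signature) (A : algebra S) (R : set (A * A)) :
  U2_admissible R -> U_admissible R.
Proof.
case=> T1 [T2 [ad1 ad2 ->]]; exists [set T1; T2]; split.
- by exists T1; left.
- by move=> _ [] ->.
- by rewrite bigcup_setU !bigcup_set1.
Qed.

Lemma U_admissible_in_sigma_range (S : signature) (A : algebra S)
    (rs : sigma_range) (R : set (A * A)) :
  in_sigma_range rs R -> U_admissible R.
Proof. by case: rs => // /U_admissible_of_U2. Qed.

Lemma U2_admissible_in_sigma_range (S : signature) (A : algebra S)
    (rs : sigma_range) (R : set (A * A)) :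
  U2_admissible R -> in_sigma_range rs R.
Proof. by case: rs => // /U_admissible_of_U2. Qed.

(** * From terms to relational inclusions *)

(** For a congruence the nesting below is superfluous, as both sides are
    related to [x].  Without transitivity, write [u x y z] as
    [v (u x y z) y (u x y z)] and [v x y z] as [v (u x y x) y (u z y z)]; the
    two expressions differ only in that, inside each of the outer arguments of
    [v], a single [x] or [z] is replaced by the other, so compatibility of [u]
    and then of [v] relates them. *)
Lemma tolerance_step (T : Type) (alpha : set (T * T)) (u v : T -> T -> T -> T)
    (x y z : T) :
  (forall a, alpha (a, a)) -> (forall a b, alpha (a, b) -> alpha (b, a)) ->
  (forall a a' b b', alpha (a, a') -> alpha (b, b') ->
     alpha (u a y b, u a' y b')) ->
  (forall a a' b b', alpha (a, a') -> alpha (b, b') ->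
     alpha (v a y b, v a' y b')) ->
  (forall a, u a y a = a) -> (forall a, v a y a = a) ->
  alpha (x, z) -> alpha (u x y z, v x y z).
Proof.
move=> rfl sym uc vc uid vid xz.
have : alpha (v (u x y z) y (u x y z), v (u x y x) y (u z y z)).
  by apply: vc; apply: uc => //; exact: sym.
by rewrite vid !uid.
Qed.

Section LinkTerms.
Variables (S : signature) (A : algebra S) (h : nat).
Variables (f : 'I_h -> idx12) (s : 'I_h -> term S 'I_4).
Hypotheses (h_gt0 : 0 < h) (idA : term_identities f s A).

(** The links of the chain: [s_i] with its fourth argument at the start of the
    [i]-th step.  The extra value [z] at [i = h] turns the last identity of the
    theorem into an instance of the general pattern [link_succ]. *)
Definition link (i : nat) (x y z : A) : A :=
  if insub i is Some j then eval4 (s j) x y z (w_ (f j) x y z) else z.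

Lemma link_ord (i : 'I_h) x y z : link i x y z = eval4 (s i) x y z (w_ (f i) x y z).
Proof. by rewrite /link valK. Qed.

Lemma link_last x y z : link h x y z = z.
Proof. by rewrite /link insubN // ltnn. Qed.

Lemma link_first x y z : link 0 x y z = x.
Proof.
by have [E _ _ _] := idA x y z; rewrite (link_ord (Ordinal h_gt0)) -E.
Qed.

Lemma link_succ (i : 'I_h) x y z :
  link i.+1 x y z = eval4 (s i) x y z (w'_ (f i) x y z).
Proof.
have [_ El Es _] := idA x y z; have := ltn_ord i; rewrite leq_eqVlt.
case/orP=> [/eqP E|lt_ih]; first by rewrite E link_last El.
by rewrite (link_ord (Ordinal lt_ih)) (Es i (Ordinal lt_ih)).
Qed.

Lemma link_idem (i : nat) x y : i <= h -> link i x y x = x.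
Proof.
rewrite leq_eqVlt => /orP [/eqP ->|]; first exact: link_last.
case: i => [_|i lt_ih]; first exact: link_first.
have [_ _ _ E] := idA x y x; rewrite (link_ord (Ordinal lt_ih)).
by rewrite -(E (Ordinal (ltnW lt_ih))).
Qed.

Lemma link_compatible (alpha : set (A * A)) (i : nat) x x' y z z' :
  reflexive_rel alpha -> admissible alpha ->
  alpha (x, x') -> alpha (z, z') -> alpha (link i x y z, link i x' y z').
Proof.
move=> rfl adm xx' zz'; rewrite /link; case: insub => [j|//].
by apply: admissible_eval4 => //; case: (f j).
Qed.

Lemma link_shift (R : idx12 -> set (A * A)) (i : 'I_h) x y z :
  (forall j, reflexive_admissible (R j)) -> R idx1 (x, y) -> R idx2 (y, z) ->
  R (f i) (link i x y z, link i.+1 x y z).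
Proof.
move=> adR Rxy Ryz; rewrite link_ord link_succ.
have [rfl adm] := adR (f i).
by apply: admissible_eval4 => //; case: (f i).
Qed.

End LinkTerms.

Lemma condition_R_of_terms (S : signature) (h : nat) (ra : alpha_range)
    (f : 'I_h -> idx12) (K : algebra S -> Prop) :
  0 < h -> condition_terms f K -> condition_R ra f K.
Proof.
move=> h_gt0 [s idK] A /idK idA alpha R /tolerance_in_alpha_range.
case=> rfl sym adm adR [x z] [/= axz [y /= Rxy Ryz]].
apply/rcomp_familyP; exists (fun i => link f s i x y z); split.
- exact: link_first.
- exact: link_last.
move=> i; split; last exact: link_shift.
apply: tolerance_step => //.
- by move=> *; exact: link_compatible.
- by move=> *; exact: link_compatible.
- by move=> a; apply: link_idem => //; exact: ltnW.
- by move=> a; exact: link_idem.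
Qed.

(** A pair of [rcomp sigma sigma] only involves two of the relations whose
    union is [sigma]. *)
Lemma condition_U_of_R (S : signature) (h : nat) (ra : alpha_range)
    (rs : sigma_range) (f : 'I_h -> idx12) (K : algebra S -> Prop) :
  condition_R ra f K -> condition_U h ra rs K.
Proof.
move=> RK A KA alpha sigma alphaP /U_admissible_in_sigma_range.
case=> Phi [_ PhiP ->] [x z] [/= axz [y /= [T1 Phi1 T1xy] [T2 Phi2 T2yz]]].
pose R j := if j is idx1 then T1 else T2.
have PhiR j : Phi (R j) by case: j.
have: rcomp_family (fun i : 'I_h => alpha `&` R (f i)) (x, z).
  apply: (RK A KA) => //; first by move=> j; exact: PhiP.
  by split=> //; exists y.
apply: sub_rcomp_family => i p [ap Rp]; split=> //.
by exists (R (f i)).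
Qed.

(** * From relational inclusions on the free algebra to terms *)

(** The elements satisfying [P] form a subalgebra, which lies in the variety.
    Composed with its inclusion, the homomorphism into it that fixes the
    generators is an endomorphism of [F] that fixes the generators, hence the
    identity; so the subalgebra is all of [F]. *)
Lemma free_algebra_ind (S : signature) (V : algebra S -> Prop) (X : Type)
    (x0 : X) (F : algebra S) (g : X -> F) (P : F -> Prop) :
  is_variety V -> free_algebra V g -> (forall x, P (g x)) ->
  (forall (o : symbol S) (a : 'I_(arity o) -> F),
     (forall i, P (a i)) -> P (op F o a)) ->
  forall q, P q.
Proof.
move=> [E VE] [VF univ] Pg Pop.
pose G := Algebra {q | P q}
  (fun o (a : 'I_(arity o) -> {q | P q}) =>
     exist P (op F o (fun i => sval (a i))) (Pop o _ (fun i => svalP (a i))))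
  (inhabits (exist P (g x0) (Pg x0))).
have val_hom : homomorphism (fun q : G => sval q) by [].
have VG : V G.
  rewrite VE => st Est e.
  have: sval (eval e st.1) = sval (eval e st.2).
    rewrite !(homomorphism_eval _ _ val_hom).
    by move: VF; rewrite VE; exact.
  by case: (eval e st.1) (eval e st.2) => [a Pa] [b Pb] /=; exact: eq_exist.
have [phi [[hphi phig] _]] := univ G VG (fun x => exist P (g x) (Pg x)).
have [id' [_ uniq_id]] := univ F VF g.
have E1 : id' = (fun q => sval (phi q)).
  apply: uniq_id; split; first by move=> o a; rewrite hphi.
  by apply/funext => x /=; have /= -> := congr1 (fun k => k x) phig.
have E2 : id' = id by apply: uniq_id.
move=> q; have -> : q = sval (phi q) by rewrite -[LHS](congr1 (fun k => k q) E2) E1.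
exact: svalP.
Qed.

(** Its pairs [(a, b)] are those obtained from the pair
    [(w_ j x y z, w'_ j x y z)] by a unary polynomial operation with parameters
    among [x], [y], [z]. *)
Definition shift_rel (S : signature) (A : algebra S) (x y z : A) (j : idx12) :
    set (A * A) :=
  [set p | exists t : term S 'I_4,
     p = (eval4 t x y z (w_ j x y z), eval4 t x y z (w'_ j x y z))].

Lemma shift_rel_generator (S : signature) (A : algebra S) (x y z : A)
    (j : idx12) : shift_rel x y z j (w_ j x y z, w'_ j x y z).
Proof. by exists (Var (inord 3)); rewrite /eval4 /= !(tnth_nth x) !inordK. Qed.

Definition triple (T : Type) (x y z : T) (i : 'I_3) : T :=
  tnth [tuple x; y; z] i.

Section FreeThree.
Variables (S : signature) (V : algebra S -> Prop) (F : algebra S).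
Variable g : 'I_3 -> F.
Hypotheses (varV : is_variety V) (freeF : free_algebra V g).

Let x := g (inord 0).
Let y := g (inord 1).
Let z := g (inord 2).

Lemma free3_homomorphism (B : algebra S) (a b c : B) : V B ->
  exists phi : F -> B, [/\ homomorphism phi, phi x = a, phi y = b & phi z = c].
Proof.
move=> VB; have [phi [[hphi E] _]] := freeF.2 B VB (triple a b c).
exists phi; split=> //; rewrite -[LHS]/((phi \o g) _) E /triple;
  by rewrite (tnth_nth a) inordK.
Qed.

(** Quantifying over all [w] makes the term independent of its fourth variable
    up to equality in [F]. *)
Lemma free3_term (q : F) :
  exists t : term S 'I_4, forall w, eval4 t x y z w = q.
Proof.
move: q; apply: (free_algebra_ind (inord 0 : 'I_3) varV freeF) => [i|o a /choice [t tE]].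
  exists (Var (inord i)) => w; rewrite /eval4 /= (tnth_nth x) inordK; last first.
    exact: ltn_trans (ltn_ord i) _.
  rewrite -[in RHS](inord_val i) /x /y /z.
  by case: i => [[|[|[|//]]] ?].
exists (App o t) => w; rewrite /eval4 /=; congr (op _ _).
by apply/funext => i; exact: tE.
Qed.

Lemma shift_rel_reflexive_admissible (j : idx12) :
  reflexive_admissible (shift_rel x y z j).
Proof.
split=> [q|o a b /choice [t tE]].
  by have [t tE] := free3_term q; exists t; rewrite !tE.
by exists (App o t); rewrite /eval4 /=; congr (_, _);
  congr (op _ _); apply/funext => i; case: (tE i).
Qed.

(** Each identity is an equality between elements of [F], or between their
    images under [phi]; a homomorphism from [F] that sends the generators to
    prescribed elements turns it into the identity at these elements. *)
Lemma terms_of_chain (h : nat) (f : 'I_h -> idx12) (phi : F -> F) :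
  homomorphism phi -> phi x = x -> phi y = y -> phi z = x ->
  rcomp_family (fun i : 'I_h =>
    [set p | phi p.1 = phi p.2] `&` shift_rel x y z (f i)) (x, z) ->
  condition_terms f V.
Proof.
move=> hphi phix phiy phiz /rcomp_familyP [c [c0 ch Qc]].
have /choice [s sE] : forall i : 'I_h, exists t : term S 'I_4,
    c i = eval4 t x y z (w_ (f i) x y z) /\
    c i.+1 = eval4 t x y z (w'_ (f i) x y z).
  by move=> i; have [_ [t [-> ->]]] := Qc i; exists t.
have phic (i : nat) : i <= h -> phi (c i) = x.
  elim: i => [|i IH] le_ih; first by rewrite c0.
  by have [/= <- _] := Qc (Ordinal le_ih); apply: IH; exact: ltnW.
exists s => B VB a b d.
have [psi [hpsi psix psiy psiz]] := free3_homomorphism a b d VB.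
have [chi [hchi chix chiy _]] := free3_homomorphism a b a VB.
have evw i : psi (c (nat_of_ord i)) = eval4 (s i) a b d (w_ (f i) a b d).
  by rewrite (sE i).1 homomorphism_eval4 // homomorphism_w psix psiy psiz.
have evw' i : psi (c (nat_of_ord i).+1) = eval4 (s i) a b d (w'_ (f i) a b d).
  by rewrite (sE i).2 homomorphism_eval4 // homomorphism_w' psix psiy psiz.
split=> [i i0|i ih|i j ij|_ j _].
- by rewrite -evw i0 c0.
- by rewrite -evw' ih ch.
- by rewrite -evw' -evw ij.
- have := phic j (ltnW (ltn_ord j)).
  rewrite (sE j).1 homomorphism_eval4 // homomorphism_w phix phiy phiz.
  move/(congr1 chi); rewrite homomorphism_eval4 // homomorphism_w.
  by rewrite chix chiy.
Qed.

Lemma collapse_homomorphism :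
  exists phi : F -> F, [/\ homomorphism phi, phi x = x, phi y = y & phi z = x].
Proof. exact: free3_homomorphism freeF.1. Qed.

Lemma shift_rel_rcomp : rcomp (shift_rel x y z idx1) (shift_rel x y z idx2) (x, z).
Proof.
by exists y; [exact: (shift_rel_generator x y z idx1) |
              exact: (shift_rel_generator x y z idx2)].
Qed.

Lemma terms_of_condition_R (h : nat) (ra : alpha_range) (f : 'I_h -> idx12) :
  condition_R ra f (eq F) -> condition_terms f V.
Proof.
have [phi [hphi phix phiy phiz]] := collapse_homomorphism.
move=> RF; apply: (terms_of_chain hphi) => //; apply: (RF F) => //.
- exact/congruence_in_alpha_range/congruence_kernel.
- exact: shift_rel_reflexive_admissible.
- by split; [rewrite /= phix phiz | exact: shift_rel_rcomp].
Qed.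

Lemma terms_of_condition_U (h : nat) (ra : alpha_range) (rs : sigma_range) :
  condition_U h ra rs (eq F) -> exists f : 'I_h -> idx12, condition_terms f V.
Proof.
have [phi [hphi phix phiy phiz]] := collapse_homomorphism.
pose alpha := [set p : F * F | phi p.1 = phi p.2].
move=> UF; have /rcomp_family_bigcup [f Rf] : rcomp_family
    (fun _ : 'I_h => alpha `&` \bigcup_j shift_rel x y z j) (x, z).
  apply: (UF F) => //.
  - exact/congruence_in_alpha_range/congruence_kernel.
  - apply/U2_admissible_in_sigma_range/U2_admissibleP.
    exact: shift_rel_reflexive_admissible.
  - split; first by rewrite /alpha /= phix phiz.
    by have [u Rxu Ruz] := shift_rel_rcomp; exists u; [exists idx1 | exists idx2].
by exists f; exact: terms_of_chain Rf.
Qed.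

Lemma condition_R_free3 (h : nat) (ra : alpha_range) (f : 'I_h -> idx12) :
  condition_R ra f V -> condition_R ra f (eq F).
Proof. by move=> RV A <-; exact: (RV F freeF.1). Qed.

Lemma condition_U_free3 (h : nat) (ra : alpha_range) (rs : sigma_range) :
  condition_U h ra rs V -> condition_U h ra rs (eq F).
Proof. by move=> UV A <-; exact: (UV F freeF.1). Qed.

Lemma condition_terms_free3 (h : nat) (f : 'I_h -> idx12) :
  condition_terms f V -> condition_terms f (eq F).
Proof. by move=> [s sV]; exists s => A <-; exact: (sV F freeF.1). Qed.

End FreeThree.

(** * Equivalence of the conditions *)

Theorem theorem4p1 (S : signature) (V : algebra S -> Prop) (h : nat)
    (varV : is_variety V) (h_gt0 : (0 < h)%N) :
  [/\ (* (1) and (2) are equivalent, whatever the ranges of alpha and sigma *)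
      forall (ra : alpha_range) (rs : sigma_range),
        condition_U h ra rs V <-> condition_f h V,
      (* for any given f, the conditions (2)(a) and (2)(b) are equivalent *)
      forall (f : 'I_h -> idx12) (ra : alpha_range),
        condition_R ra f V <-> condition_terms f V
    & (* each condition holds for V iff it holds for F_V(3) *)
      forall (F : algebra S) (g : 'I_3 -> F), free_algebra V g ->
        [/\ forall (ra : alpha_range) (rs : sigma_range),
              condition_U h ra rs V <-> condition_U h ra rs (eq F),
            forall (f : 'I_h -> idx12) (ra : alpha_range),
              condition_R ra f V <-> condition_R ra f (eq F),
            forall f : 'I_h -> idx12,
              condition_terms f V <-> condition_terms f (eq F)
          & condition_f h V <-> condition_f h (eq F)]].
Proof.
have toR (f : 'I_h -> idx12) ra (K : algebra S -> Prop) :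
    condition_terms f K -> condition_R ra f K.
  exact: condition_R_of_terms.
have toU (f : 'I_h -> idx12) ra rs : condition_terms f V -> condition_U h ra rs V.
  by move/(toR f ra); exact: condition_U_of_R.
have [F0 [g0 free0]] := free_algebra_exists (inord 0 : 'I_3) varV.
have RT (f : 'I_h -> idx12) ra : condition_R ra f V -> condition_terms f V.
  by move/(condition_R_free3 free0); exact: terms_of_condition_R free0 _ _ _.
have fT : condition_f h V -> exists f : 'I_h -> idx12, condition_terms f V.
  by case=> f [[ra /RT]|]; exists f.
split=> [ra rs|f ra|F g freeF].
- split=> [/(condition_U_free3 free0)|/fT [f]]; last exact: toU.
  by case/(terms_of_condition_U varV free0) => f tV; exists f; right.
- by split; [exact: RT | exact: toR].
have RFT (f : 'I_h -> idx12) ra : condition_R ra f (eq F) -> condition_terms f V.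
  exact: terms_of_condition_R freeF _ _ _.
have TFT (f : 'I_h -> idx12) : condition_terms f (eq F) -> condition_terms f V.
  by move/(toR f Congruences); exact: RFT.
split=> [ra rs|f ra|f|].
- split; first exact: (condition_U_free3 freeF).
  by case/(terms_of_condition_U varV freeF) => f; exact: toU.
- by split=> [|/RFT]; [exact: (condition_R_free3 freeF) | exact: toR].
- by split; [exact: (condition_terms_free3 freeF) | exact: TFT].
- split=> [/fT [f tV]|[f fF]]; exists f; right.
    exact: (condition_terms_free3 freeF tV).
  by case: fF => [[ra]|]; [exact: RFT | exact: TFT].
Qed.
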